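(* Let $\Gamma\subset\mathbb R^2$ be a compact rectifiable curve which is not contained in a line. Suppose that $E\subset\mathbb R^2$ contains a countably $1$-rectifiable set $R$ satisfying \[ \mathcal H^1(R)>0. \] Then there are compact sets \[ K_+\subset E+\Gamma\qquad\text{and}\qquad K_-\subset E-\Gamma \] such that $|K_+|>0$ and $|K_-|>0$.
   Context: A compact rectifiable curve is the image of a continuous rectifiable path on a compact interval. A set $R\subset\mathbb R^2$ is countably $1$-rectifiable if it is covered, up to an $\mathcal H^1$-null set, by the images of countably many Lipschitz maps from $\mathbb R$ to $\mathbb R^2$. Here $\mathcal H^1$ is one-dimensional Hausdorff measure, $E\pm\Gamma=\{x\pm y:x\in E,\ y\in\Gamma\}$, and $|\cdot|$ denotes planar Lebesgue measure.
   Formalization: The countably 1-rectifiable set R is additionally assumed H^1-measurable (in Carathéodory's sense); without this the claim fails, e.g. for E = R = B×{0} with B a Bernstein set and Γ = [0,1]×{0} ∪ {0}×[0,1]. *)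

(* Defs.v *)
From HB Require Import structures.
From mathcomp Require Import all_boot all_order all_algebra.
From mathcomp Require Import all_classical all_reals all_analysis.
Import Order.TTheory GRing.Theory Num.Theory numFieldNormedType.Exports.

Set Implicit Arguments.
Unset Strict Implicit.
Unset Printing Implicit Defensive.

Local Open Scope classical_set_scope.
Local Open Scope ring_scope.

(* The library norm on [R * R] is the sup norm, so the Euclidean norm is
   introduced here; both induce the (product) topology used for continuity and
   compactness. *)
Definition enorm {R : realType} (p : R * R) : R :=
  Num.sqrt (p.1 ^+ 2 + p.2 ^+ 2).

(* 0 is thrown in so that the empty set has diameter 0 rather than -oo. *)
Definition ediam {R : realType} (A : set (R * R)) : \bar R :=
  ereal_sup (0%E |` [set (enorm (x - y))%:E | x in A & y in A]).

Definition hausdorff1_delta {R : realType} (delta : R) (A : set (R * R)) :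
    \bar R :=
  ereal_inf [set (\sum_(0 <= i <oo) ediam (U i))%E |
    U in [set U : nat -> set (R * R) |
      A `<=` \bigcup_i U i /\ forall i, (ediam (U i) <= delta%:E)%E]].

(* No normalising factor is needed in dimension one: a unit segment has
   measure 1.  This is the outer measure, defined on all subsets. *)
Definition hausdorff1 {R : realType} (A : set (R * R)) : \bar R :=
  ereal_sup [set hausdorff1_delta delta A | delta in [set d : R | 0 < d]].

Definition polygonal_length {R : realType} (a b : R) (gamma : R -> R * R)
    (s : seq R) : R :=
  let F := gamma \o nth b (a :: s) in
  \sum_(0 <= i < size s) enorm (F i.+1 - F i).

Definition rectifiable_path {R : realType} (a b : R) (gamma : R -> R * R) :=
  has_ubound [set polygonal_length a b gamma s | s in itv_partition a b].

Definition compact_rectifiable_curve {R : realType} (Gamma : set (R * R)) :=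
  exists (a b : R) (gamma : R -> R * R),
    [/\ a <= b, {within `[a, b], continuous gamma},
        rectifiable_path a b gamma & Gamma = gamma @` `[a, b]].

Definition line {R : realType} (p v : R * R) : set (R * R) :=
  [set p + t *: v | t in [set: R]].

Definition contained_in_line {R : realType} (A : set (R * R)) :=
  exists p v : R * R, v != 0 /\ A `<=` line p v.

Definition elipschitz {R : realType} (f : R -> R * R) :=
  exists k : R, forall s t, enorm (f s - f t) <= k * `|s - t|.

Definition countably_1_rectifiable {R : realType} (A : set (R * R)) :=
  exists f : nat -> R -> R * R, (forall i, elipschitz (f i)) /\
    hausdorff1 (A `\` \bigcup_i range (f i)) = 0%E.

Definition planar_lebesgue {R : realType} : set (R * R) -> \bar R :=
  (@lebesgue_measure R \x @lebesgue_measure R)%E.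

(* Main.v *)
Require Import Defs.
From HB Require Import structures.
From mathcomp Require Import all_boot all_order all_algebra.
From mathcomp Require Import all_classical all_reals all_analysis.
From mathcomp Require Import ring lra.
Import Order.TTheory GRing.Theory Num.Theory numFieldNormedType.Exports.

Set Implicit Arguments.
Unset Strict Implicit.
Unset Printing Implicit Defensive.

(** Why the theorem holds. Let [f] be a Lipschitz curve meeting the rectifiable
    part of [E] in positive length and let [g] be a Lipschitz parametrization of
    [Gamma]. If [f] had derivative [w] on a set [C] of parameters, [g] had
    derivative [v] on a set [U], and [w], [v] were independent, then
    [(s, u) |-> f s + g u] would look like the invertible linear map
    [(s, u) |-> s *: w + u *: v] on [C * U]. Nothing as strong as a local
    inverse or an area formula is needed: it suffices that the chords of [f]
    over [C] and those of [g] over [U] are multiples of [w] and [v] up to a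
    small relative error ([almost_affine]). The sum map then expands distances by
    a factor bounded below, its inverse is Lipschitz on the image, and so the
    image of [C * U] has positive area as soon as [C] and [U] have positive
    length ([expanding_image_pos]). Closing the pieces keeps the chord
    condition, which makes the image compact. The difference set is the same
    statement with [- g] and slope [- v].

    The pieces come from differentiability almost everywhere of Lipschitz
    functions ([lipschitz_ae_derivable]) and from a countable decomposition of
    the set of differentiability points ([slope_pieces]): some derivative is such
    that for every precision there is a piece, of non-null image, whose chords
    are multiples of it to that precision. That derivative can be chosen nonzero
    for [f], and outside the line spanned by [w] for [g], by a one-dimensional
    Sard lemma ([hausdorff1_image_slope0]): the parameters where [f] has zero
    derivative have null image, and those where the derivative of [g] is parallel
    to [w] have null image after projection along [w], whereas the projection of
    the whole of [Gamma] is a nondegenerate interval because [Gamma] is connected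
    and not contained in a line.

    Two points need care. The piece for [f] must be mapped into the given set
    [A], which is measurable only in the sense of Caratheodory with respect to
    Hausdorff measure; a Borel hull turns this into a Borel set of parameters
    ([caratheodory_preimage_compact]). And the path given for [Gamma] is merely
    continuous and of finite length: its reparametrization by accumulated
    variation is extended to a Lipschitz map of the line
    ([rectifiable_path_lipschitz]).

    Estimates use the sup norm of the plane, which is within a factor 2 of the
    Euclidean one. *)

Local Open Scope classical_set_scope.
Local Open Scope ring_scope.

(** * Euclidean and sup norms, diameters *)

Section Norm.
Context {R : realType}.
Implicit Types p q : R * R.

Lemma norm_pairE p : `|p| = Num.max `|p.1| `|p.2|.
Proof. by []. Qed.

Lemma norm_fst_le p : `|p.1| <= `|p|.
Proof. by rewrite norm_pairE le_max lexx. Qed.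

Lemma norm_snd_le p : `|p.2| <= `|p|.
Proof. by rewrite norm_pairE le_max lexx orbT. Qed.

Lemma enorm_ge0 p : 0 <= enorm p.
Proof. exact: sqrtr_ge0. Qed.

Lemma norm_le_enorm p : `|p| <= enorm p.
Proof.
rewrite norm_pairE ge_max -!sqrtr_sqr /enorm !ler_sqrt ?addr_ge0 ?sqr_ge0//.
by rewrite lerDl lerDr !sqr_ge0.
Qed.

Lemma enorm_le_norm p : enorm p <= 2 * `|p|.
Proof.
have p0 : 0 <= 2 * `|p| by rewrite mulr_ge0.
rewrite -(ler_pXn2r (n:=2))// ?nnegrE ?enorm_ge0// /enorm sqr_sqrtr; last first.
  by rewrite addr_ge0 ?sqr_ge0.
rewrite -(real_normK (num_real p.1)) -(real_normK (num_real p.2)).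
have := norm_fst_le p; have := norm_snd_le p.
have := normr_ge0 p.1; have := normr_ge0 p.2; nra.
Qed.

Lemma continuous_enorm : continuous (@enorm R).
Proof.
move=> p; rewrite /enorm.
apply: (@continuous_comp _ _ _ (fun p : R * R => p.1 ^+ 2 + p.2 ^+ 2) Num.sqrt).
  by apply: cvgD; apply: (@continuous_comp _ _ _ _ (fun x : R => x ^+ 2));
    [exact: cvg_fst|exact: exprn_continuous|exact: cvg_snd|exact: exprn_continuous].
exact: sqrt_continuous.
Qed.

End Norm.

Lemma closed_preimage_continuous (T U : topologicalType) (f : T -> U) (D : set U) :
  continuous f -> closed D -> closed (f @^-1` D).
Proof. by move=> cf; apply: preimage_closed => x _; exact: cf. Qed.

Section Diameter.
Context {R : realType}.
Implicit Types A B : set (R * R).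
Local Open Scope ereal_scope.

Lemma ediam_ge0 A : 0 <= ediam A.
Proof. by apply: ereal_sup_ubound; left. Qed.

Lemma ediam_le A B : A `<=` B -> ediam A <= ediam B.
Proof.
move=> AB; apply: le_ereal_sup => z [->|[x Ax [y Ay <-]]]; first by left.
by right; exists x; [exact: AB|exists y => //; exact: AB].
Qed.

Lemma ediam_ub A x y : A x -> A y -> (enorm (x - y))%:E <= ediam A.
Proof. by move=> Ax Ay; apply: ereal_sup_ubound; right; exists x => //; exists y. Qed.

Lemma ediam_lub A (d : \bar R) : 0 <= d ->
  (forall x y, A x -> A y -> (enorm (x - y))%:E <= d) -> ediam A <= d.
Proof.
move=> d0 Ad; apply: ge_ereal_sup => z [->//|[x Ax [y Ay <-]]]; exact: Ad.
Qed.

Lemma ediam0 : ediam (set0 : set (R * R)) = 0.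
Proof. by apply/eqP; rewrite eq_le ediam_ge0 andbT; apply: ediam_lub. Qed.

Lemma ediam_closure A : ediam (closure A) = ediam A.
Proof.
apply/eqP; rewrite eq_le (ediam_le (@subset_closure _ A)) andbT.
have [->|Aoo] := eqVneq (ediam A) +oo; first by rewrite leey.
have Afin : ediam A \is a fin_num by rewrite ge0_fin_numE ?ediam_ge0// ltey.
pose cl (x : R * R) := [set y | (enorm (x - y) <= fine (ediam A))%R].
have ccl x : closed (cl x).
  apply: (@closed_preimage_continuous (R * R)%type R (fun y => enorm (x - y)%R)
    [set r : R | r <= fine (ediam A)]%R); last exact: closed_le.
  move=> y; apply: (@continuous_comp _ _ _ (fun y : R * R => x - y)%R (@enorm R));
    last exact: continuous_enorm.
  by apply: cvgB; [exact: cvg_cst|exact: cvg_id].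
have enormC (x y : R * R) : enorm (x - y)%R = enorm (y - x)%R.
  by rewrite /enorm /= -(sqrrN (x.1 - _)%R) -(sqrrN (x.2 - _)%R) !opprB.
(* two passes: first only the second point ranges over the closure *)
have half x y : A x -> closure A y -> (enorm (x - y) <= fine (ediam A))%R.
  move=> Ax clAy; apply: (ccl x); apply: closureS clAy => z Az.
  by rewrite /cl /= -lee_fin fineK//; exact: ediam_ub.
apply: ediam_lub => [|x y clx cly]; first exact: ediam_ge0.
rewrite -(fineK Afin) lee_fin; apply: (ccl x); apply: closureS cly => z Az.
by rewrite /cl /= enormC; exact: half.
Qed.

End Diameter.

(** * Hausdorff measure as an outer measure *)

Section HausdorffOuterMeasure.
Context {R : realType}.
Local Open Scope ereal_scope.
Implicit Types (A B : set (R * R)) (d : R).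

Lemma hausdorff1_delta_ge0 d A : 0 <= hausdorff1_delta d A.
Proof.
by apply: le_ereal_inf_tmp => _ [U _ <-]; apply: nneseries_ge0 => n _ _; exact: ediam_ge0.
Qed.

Lemma hausdorff1_delta_le_cover d A (U : nat -> set (R * R)) :
  A `<=` \bigcup_i U i -> (forall i, ediam (U i) <= d%:E) ->
  hausdorff1_delta d A <= \sum_(0 <= i <oo) ediam (U i).
Proof.
move=> AU Ud; apply: ge_ereal_inf; exists (\sum_(0 <= i <oo) ediam (U i)) => //.
by exists U.
Qed.

Lemma le_hausdorff1_delta d : {homo @hausdorff1_delta R d : A B / A `<=` B >-> A <= B}.
Proof.
move=> A B AB; apply: le_ereal_inf_tmp => _ [U [BU Ud] <-].
by apply: hausdorff1_delta_le_cover => //; exact: subset_trans BU.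
Qed.

(** [hausdorff1_delta d] is the outer measure that the general covering
    construction attaches to the set function equal to the diameter on sets of
    diameter at most [d] and to [+oo] on the others, all sets being declared
    measurable; countable subadditivity is inherited from there. *)
Lemma hausdorff1_delta_sigma_subadditive d : sigma_subadditive (@hausdorff1_delta R d).
Proof.
pose T := g_sigma_algebraType [set: set (R * R)].
pose c (U : set T) : \bar R := if ediam U <= d%:E then ediam U else +oo.
have c0 U : 0 <= c U by rewrite /c; case: ifPn => // _; exact: ediam_ge0.
suff -> : hausdorff1_delta d = @mu_ext _ T R c.
  exact: (@mu_ext_sigma_subadditive _ T R c c0).
apply/funext => A; apply/eqP; rewrite eq_le; apply/andP; split.
  apply: le_ereal_inf_tmp => _ [U [_ AU] <-].
  have [Ud|/existsNP[i /negP Ui]] := pselect (forall i, ediam (U i) <= d%:E).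
    rewrite (_ : \sum_(k <oo) c (U k) = \sum_(0 <= k <oo) ediam (U k)).
      exact: hausdorff1_delta_le_cover.
    by apply: eq_eseriesr => i _; rewrite /c Ud.
  rewrite (eseries_pinfty _ _ (_ : c (U i) = +oo)) ?leey//.
    by move=> n _; rewrite -ltNye (lt_le_trans _ (c0 _)).
  by rewrite /c (negbTE Ui).
apply: le_ereal_inf_tmp => _ [U [AU Ud] <-]; apply: ge_ereal_inf.
exists (\sum_(k <oo) c (U k)).
  by exists U => //; split => // i; exact: sub_sigma_algebra.
by apply: lee_nneseries => [k _ _|k _]; [exact: c0|rewrite /c Ud].
Qed.

Lemma hausdorff1_ge_delta d A : (0 < d)%R -> hausdorff1_delta d A <= hausdorff1 A.
Proof. by move=> d0; apply: ereal_sup_ubound; exists d. Qed.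

Lemma hausdorff1_lub A (y : \bar R) :
  (forall d, (0 < d)%R -> hausdorff1_delta d A <= y) -> hausdorff1 A <= y.
Proof. by move=> Ay; apply: ge_ereal_sup => _ [d d0 <-]; exact: Ay. Qed.

Lemma hausdorff1_ge0 A : 0 <= hausdorff1 A.
Proof.
by apply: le_trans (hausdorff1_ge_delta A ltr01); exact: hausdorff1_delta_ge0.
Qed.

Lemma le_hausdorff1 : {homo @hausdorff1 R : A B / A `<=` B >-> A <= B}.
Proof.
move=> A B AB; apply: hausdorff1_lub => d d0.
by apply: le_trans (hausdorff1_ge_delta B d0); exact: le_hausdorff1_delta.
Qed.

Lemma hausdorff1_sigma_subadditive : sigma_subadditive (@hausdorff1 R).
Proof.
move=> A; apply: hausdorff1_lub => d d0.
apply: le_trans (hausdorff1_delta_sigma_subadditive _ _) _.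
apply: lee_nneseries => [i _ _|i _]; first exact: hausdorff1_delta_ge0.
exact: hausdorff1_ge_delta.
Qed.

Lemma hausdorff10 : hausdorff1 (set0 : set (R * R)) = 0.
Proof.
apply/eqP; rewrite eq_le hausdorff1_ge0 andbT; apply: hausdorff1_lub => d d0.
apply: le_trans (hausdorff1_delta_le_cover (U := fun=> set0) _ _) _ => //.
  by move=> i; rewrite ediam0 lee_fin ltW.
by rewrite eseries0// => i _ _; rewrite ediam0.
Qed.

HB.instance Definition _ := isOuterMeasure.Build R (R * R)%type (@hausdorff1 R)
  hausdorff10 hausdorff1_ge0 le_hausdorff1 hausdorff1_sigma_subadditive.

End HausdorffOuterMeasure.

Lemma outer_measure_null_sub (R : realType) T (mu : {outer_measure set T -> \bar R})
  (A B : set T) : A `<=` B -> mu B = 0%E -> mu A = 0%E.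
Proof.
by move=> AB B0; apply/eqP; rewrite eq_le outer_measure_ge0 andbT -B0 le_outer_measure.
Qed.

Lemma outer_measure_null_bigcup (R : realType) T (mu : {outer_measure set T -> \bar R})
  (A : set T) (B : nat -> set T) :
  A `<=` \bigcup_i B i -> (forall i, mu (B i) = 0%E) -> mu A = 0%E.
Proof.
move=> AB B0; apply: outer_measure_null_sub AB _; apply/eqP.
rewrite eq_le outer_measure_ge0 andbT.
by rewrite (le_trans (outer_measure_sigma_subadditive mu B))// eseries0.
Qed.

(** * Lebesgue outer measure and grids of the line *)

Section LebesgueOuter.
Context {R : realType}.
Local Open Scope ereal_scope.

(** A copy of [lebesgue_measure], which is defined on all sets by coverings, to
    carry the outer measure structure; it serves for sets that are not known to
    be measurable. *)
Definition leb_outer : set R -> \bar R := @lebesgue_measure R.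

Let leb_outer_ge0 (A : set R) : 0 <= leb_outer A.
Proof. move=> *; exact: (@mu_ext_ge0 _ (ocitv_type R) R _ (@wlength_ge0 R idfun)). Qed.

Let le_leb_outer : {homo leb_outer : A B / A `<=` B >-> A <= B}.
Proof. exact: (@le_mu_ext _ (ocitv_type R) R (wlength idfun)). Qed.

Let leb_outer_sigma_subadditive : sigma_subadditive leb_outer.
Proof. exact: (@mu_ext_sigma_subadditive _ (ocitv_type R) R _ (@wlength_ge0 R idfun)). Qed.

HB.instance Definition _ := isOuterMeasure.Build R R leb_outer
  (measure0 (@lebesgue_measure R)) leb_outer_ge0 le_leb_outer leb_outer_sigma_subadditive.

End LebesgueOuter.

(** Half-open intervals of length [h], numbered by natural numbers; the indices
    that encode no integer get the empty set. *)
Lemma mesh {R : realType} (h : R) : (0 < h)%R -> exists J : nat -> set R,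
  [/\ forall i, measurable (J i), trivIset setT J, \bigcup_i J i = setT,
      forall i s t, J i s -> J i t -> (`|s - t| < h)%R &
      forall i, J i !=set0 -> lebesgue_measure (J i) = h%:E].
Proof.
move=> h0.
pose I (j : int) : set R := `[j%:~R * h, (j + 1)%:~R * h[%classic.
have IE j x : I j x <-> j = Num.floor (x / h).
  rewrite /I /= in_itv /= -ler_pdivlMr// -ltr_pdivrMr//; split => [jx|->].
    by symmetry; exact: floor_def.
  by rewrite floor_le_tmp floorD1_gt.
pose J i := if pickle_inv i is Some j then I j else set0.
have JE i x : J i x <-> pickle_inv i = Some (Num.floor (x / h)).
  rewrite /J; case: (pickle_inv i) => [j|//]; rewrite IE.
  by split => [->//|[->]].
have pk (j : int) : exists i, pickle_inv i = Some j.
  by exists (pickle j); rewrite pickleK_inv.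
exists J; split.
- move=> i; rewrite /J; case: (pickle_inv i) => [j|]; last exact: measurable0.
  exact: measurable_itv.
- move=> i j _ _ [x [/JE xi /JE xj]].
  by rewrite -(@pickle_invK int i) -(@pickle_invK int j) xi xj.
- apply/seteqP; split=> x _; first exact: Logic.I.
  by have [i iE] := pk (Num.floor (x / h)); exists i => //; apply/JE.
- move=> i s t; rewrite /J; case: (pickle_inv i) => [j|//].
  by rewrite /I /= !in_itv /= !rmorphD/= !mulrDl mul1r ltr_norml; lra.
- move=> i [x]; rewrite /J; case: (pickle_inv i) => [j|//] _.
  rewrite /I lebesgue_measure_itv /= lte_fin ltr_pM2r// ltr_int ltrDl ltr01 -EFinB.
  by rewrite rmorphD/= mulrDl mul1r addrAC subrr add0r.
Qed.

(** * Lipschitz maps and null sets *)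

Lemma lipschitz_continuous {R : realType} (V : normedModType R) (f : R -> V) (K : R) :
  (forall s t, `|f s - f t| <= K * `|s - t|) -> continuous f.
Proof.
move=> fK t; apply/cvgrPdist_le => e e0; near=> s.
have C0 : 0 < `|K| + 1 by rewrite ltr_wpDl.
apply: (@le_trans _ _ ((`|K| + 1) * `|t - s|)).
  by rewrite (le_trans (fK _ _))// ler_wpM2r// (le_trans (ler_norm _))// lerDl.
rewrite mulrC -ler_pdivlMr//.
near: s; apply: (@cvgr_dist_le _ _ _ (nbhs t) _ idfun t); first exact: cvg_id.
exact: divr_gt0.
Unshelve. all: by end_near. Qed.

Section LipschitzImages.
Context {R : realType}.
Local Open Scope ereal_scope.

Let hausdorff1_delta_image_le (f : R -> R * R) (E : set R) (K r d : R) :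
  (0 < K)%R -> (0 <= d)%R -> (2 * K * r <= d)%R ->
  (forall s t, E s -> E t -> (`|s - t| <= r /\ `|f s - f t| <= K * `|s - t|)%R) ->
  hausdorff1_delta d (f @` E) <= (2 * K)%:E * lebesgue_measure E.
Proof.
move=> K0 d0 Krd fE; have K20 : (0 < 2 * K)%R by rewrite mulr_gt0.
rewrite -lee_pdivrMl//; apply: le_ereal_inf_tmp => _ [I [mI EI] <-].
have I0 i : 0 <= wlength idfun (I i) by apply: wlength_ge0.
rewrite lee_pdivrMl// -nneseriesZl; last by move=> i _; exact: I0.
pose U i := f @` (E `&` I i).
have UE s t : E s -> E t -> (enorm (f s - f t) <= 2 * K * `|s - t|)%R.
  move=> Es Et; rewrite (le_trans (enorm_le_norm _))// -mulrA ler_pM2l//.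
  by have [] := fE _ _ Es Et.
apply: le_trans (hausdorff1_delta_le_cover (U := U) _ _) _.
- by move=> _ [t Et <-]; have [i _ It] := EI _ Et; exists i => //; exists t.
- move=> i; apply: ediam_lub; first by rewrite lee_fin.
  move=> _ _ [s [Es _] <-] [t [Et _] <-]; rewrite lee_fin.
  rewrite (le_trans (UE _ _ Es Et))// (le_trans _ Krd)// ler_pM2l//.
  by have [] := fE _ _ Es Et.
apply: lee_nneseries => [i _ _|i _]; first exact: ediam_ge0.
have [[a b] _ abI] := mI i.
apply: ediam_lub => [|_ _ [s [Es Is] <-] [t [Et It] <-]].
  by apply: mule_ge0; [rewrite lee_fin ltW|exact: I0].
move: Is It; rewrite -abI /= !in_itv/= => /andP[sa sb] /andP[ta tb].
rewrite wlength_itv /= lte_fin (lt_le_trans sa sb) -EFinB -EFinM lee_fin.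
rewrite (le_trans (UE _ _ Es Et))// ler_pM2l// ler_norml; lra.
Qed.

(** Only the local behaviour of [f] matters: [D] is cut into pieces of length
    less than [r], and the Lebesgue measure adds up over the pieces because
    [D] is measurable. *)
Lemma hausdorff1_image_le (f : R -> R * R) (D : set R) (K r : R) : measurable D ->
  (0 < K)%R -> (0 < r)%R ->
  (forall s t, D s -> D t -> `|s - t| <= r -> `|f s - f t| <= K * `|s - t|)%R ->
  hausdorff1 (f @` D) <= (2 * K)%:E * lebesgue_measure D.
Proof.
move=> mD K0 r0 fD; apply: hausdorff1_lub => d d0.
have K20 : (0 < 2 * K)%R by rewrite mulr_gt0.
pose h := (Num.min r (d / (2 * K)))%R.
have h0 : (0 < h)%R by rewrite lt_min r0 divr_gt0.
have [J [mJ tJ JT Jh _]] := mesh h0.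
have -> : D = \bigcup_i (D `&` J i) by rewrite -setI_bigcupr JT setIT.
have mDJ i : setT i -> measurable (D `&` J i) by move=> _; exact: measurableI.
rewrite [lebesgue_measure _]measure_bigcup//=; last exact: trivIset_setIl.
rewrite image_bigcup (le_trans (hausdorff1_delta_sigma_subadditive _ _))//.
rewrite [X in _ <= _ * X](eq_eseriesl (Q := xpredT)); last first.
  by move=> i; exact/mem_set.
rewrite -nneseriesZl//; apply: lee_nneseries => [i _ _|i _].
  exact: hausdorff1_delta_ge0.
apply: (hausdorff1_delta_image_le (r := h)) => //; first exact: ltW.
  by rewrite mulrC -ler_pdivlMr// ge_min lexx orbT.
move=> s t [Ds Js] [Dt Jt]; have st := ltW (Jh _ _ _ Js Jt); split => //.
by apply: fD => //; rewrite (le_trans st)// ge_min lexx.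
Qed.

Lemma hausdorff1_image_null (f : R -> R * R) (K : R) (N : set R) :
  (forall s t, `|f s - f t| <= K * `|s - t|)%R ->
  leb_outer N = 0 -> hausdorff1 (f @` N) = 0.
Proof.
move=> fK /negligible_outer_measure [M [mM M0 NM]].
apply: (outer_measure_null_sub (mu := hausdorff1) (image_subset f NM)).
apply/eqP; rewrite eq_le outer_measure_ge0 andbT.
have K0 : (0 < `|K| + 1)%R by rewrite ltr_wpDl.
rewrite (le_trans (hausdorff1_image_le (K := `|K| + 1) (r := 1) mM _ _ _))// ?M0 ?mule0//.
move=> s t _ _ _; apply: le_trans (fK s t) _; apply: ler_wpM2r => //.
by rewrite (le_trans (ler_norm K))// lerDl.
Qed.

Lemma lipschitz_functional_null (q : R * R -> R) (c : R) (S : set (R * R)) :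
  (forall x y, `|q x - q y| <= c * `|x - y|)%R ->
  hausdorff1 S = 0 -> leb_outer (q @` S) = 0.
Proof.
move=> qc S0; apply/eqP; rewrite eq_le outer_measure_ge0 andbT.
pose C : R := (`|c| + 1)%R; have C0 : (0 < 2 * C)%R by rewrite mulr_gt0// ltr_wpDl.
apply/lee_addgt0Pr => /= e e0; rewrite add0e.
have : hausdorff1_delta 1 S < (e / (2 * C))%:E.
  rewrite (le_lt_trans (hausdorff1_ge_delta S ltr01))// S0 lte_fin divr_gt0//.
move=> /ereal_inf_lt[_ [U [SU U1] <-] /ltW].
rewrite mulrC EFinM lee_pdivlMl// -nneseriesZl; last by move=> i _; exact: ediam_ge0.
apply: le_trans.
apply: (@le_trans _ _ (leb_outer (\bigcup_i q @` U i))).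
  by apply: le_outer_measure; rewrite -image_bigcup; exact: image_subset.
rewrite (le_trans (outer_measure_sigma_subadditive leb_outer _))//.
apply: lee_nneseries => [i _ _|i _]; first exact: outer_measure_ge0.
have Cd0 V : 0 <= (2 * C)%:E * ediam V.
  by apply: mule_ge0; [rewrite lee_fin ltW|exact: ediam_ge0].
have [->|/set0P[u Uu]] := eqVneq (U i) set0.
  by rewrite image_set0 outer_measure0; apply: Cd0.
have dfin : ediam (U i) \is a fin_num.
  by rewrite ge0_fin_numE ?ediam_ge0// (le_lt_trans (U1 i))// ltry.
set d := fine (ediam (U i)); have d0 : (0 <= d)%R by rewrite fine_ge0 ?ediam_ge0.
apply: (@le_trans _ _ (lebesgue_measure
    (`[(q u - C * d)%R, (q u + C * d)%R]%classic : set R))).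
  apply: (@le_outer_measure _ _ leb_outer) => _ [v Uv <-] /=.
  rewrite in_itv/= -ler_distlC distrC.
  rewrite (le_trans (qc _ _))// (@le_trans _ _ (C * `|u - v|)%R)//.
    by rewrite distrC ler_wpM2r// /C (le_trans (ler_norm _))// lerDl.
  rewrite ler_pM2l ?ltr_wpDl// (le_trans (norm_le_enorm _))// -lee_fin fineK//.
  exact: ediam_ub.
rewrite lebesgue_measure_itv/=; case: ifPn => _; last first.
  exact: Cd0.
rewrite -(fineK dfin) -/d -EFinB -EFinM lee_fin; lra.
Qed.

End LipschitzImages.

(** * Differentiability almost everywhere of Lipschitz functions *)

Section LipschitzDifferentiability.
Context {R : realType}.
Local Notation lam := (@lebesgue_measure R).

Let lebesgue_stieltjes_itv (F : cumulative R R) (a b : R) : a <= b ->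
  lebesgue_stieltjes_measure F `]a, b]%classic = (F b - F a)%:E.
Proof.
move=> ab; rewrite /lebesgue_stieltjes_measure /measure_extension.
by rewrite measurable_mu_extE /= ?wlength_itv_bnd//; exact: is_ocitv.
Qed.

Let lebesgue_stieltjes_null (F : cumulative R R) (C : R) (A : set R) : 0 < C ->
  (forall s t, s <= t -> F t - F s <= C * (t - s)) ->
  lam A = 0%E -> lebesgue_stieltjes_measure F A = 0%E.
Proof.
move=> C0 FC A0; apply/eqP; rewrite eq_le andbC.
rewrite (@mu_ext_ge0 _ (ocitv_type R) R (wlength F) (@wlength_ge0 R F)) /=.
suff : (C^-1%:E * lebesgue_stieltjes_measure F A <= lam A)%E.
  by rewrite A0 lee_pdivrMl// mule0.
apply: le_ereal_inf_tmp => _ [I [mI AI] <-].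
have I0 i : (0 <= wlength idfun (I i))%E by apply: wlength_ge0.
rewrite lee_pdivrMl// -nneseriesZl//.
apply: (@le_trans _ _ (\sum_(i <oo) wlength F (I i))%E).
  by apply: ge_ereal_inf; exists (\sum_(i <oo) wlength F (I i))%E => //; exists I.
apply: lee_nneseries => [i _ _|i _]; first by apply: wlength_ge0.
have [[a b] _ /= <-] := mI i.
have [ab|ba] := leP a b; first by rewrite !wlength_itv_bnd//= -EFinM lee_fin FC.
by rewrite set_itv_ge ?wlength0 ?mule0// bnd_simp -leNgt ltW.
Qed.

Let lipschitz_ae_derivable_itv (f : R -> R) (K a b : R) : 0 <= K -> a < b ->
  (forall s t, `|f s - f t| <= K * `|s - t|) ->
  leb_outer [set t | a < t < b /\ ~ derivable f t 1] = 0%E.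
Proof.
move=> K0 ab fK.
pose F0 t := f t + K * t.
have FB s t : s <= t -> 0 <= F0 t - F0 s <= (2 * K + 1) * (t - s).
  move=> st; have := fK t s; rewrite (ger0_norm (_ : 0 <= t - s)) ?subr_ge0//.
  by rewrite ler_norml /F0 => /andP[]; nra.
have F0nd : nondecreasing F0 by move=> s t /FB /andP[]; rewrite subr_ge0.
have F0c : continuous F0.
  apply: (@lipschitz_continuous _ _ _ (2 * K)) => u v.
  rewrite /F0 opprD addrACA -mulrBr (le_trans (ler_normD _ _))// normrM (ger0_norm K0).
  by have := fK u v; lra.
pose F : cumulative R R := HB.pack F0
  (isCumulative.Build R _ R F0 F0nd (right_continuousW F0c)).
pose nu : {measure set (measurableTypeR R) -> \bar R} := lebesgue_stieltjes_measure F.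
have nuE s t : s <= t -> nu `]s, t]%classic = (F0 t - F0 s)%:E.
  by move=> st; exact: (lebesgue_stieltjes_itv F st).
have mD : measurable (`]a, b]%classic : set (measurableTypeR R)).
  exact: (@measurable_itv R).
have nuD : (nu `]a, b]%classic < +oo)%E by rewrite nuE ?ltW// ltry.
pose nuab : {finite_measure set (measurableTypeR R) -> \bar R} := mfrestr mD nuD.
have nuab_lam : nuab `<< lam.
  apply/null_content_dominatesP => A mA A0.
  rewrite /nuab /= /mfrestr/= /mrestr.
  apply: (lebesgue_stieltjes_null (C := 2 * K + 1)).
  - by rewrite ltr_wpDl ?mulr_ge0.
  - by move=> s t /FB /andP[].
  - apply: (outer_measure_null_sub (mu := leb_outer) (@subIsetl _ A _)); exact: A0.
have [g [_ gfin gint gE]] := radon_nikodym_sigma_finite nuab_lam.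
pose h := fine \o g.
have hg : EFin \o h = g by apply/funext => x /=; rewrite fineK.
have hint (A : set R) : measurable A -> lam.-integrable A (EFin \o h).
  by move=> mA; rewrite hg; exact: integrableS gint.
have hloc : locally_integrable [set: R] h.
  by apply: open_integrable_locally; [exact: openT|exact: hint].
have := FTC1Ny (fun y => hint _ (measurable_itv _)) hloc.
set G := fun x => _ => aeG.
have GE x : a <= x <= b -> G x = F0 x - F0 a.
  move=> /andP[ax xb]; transitivity (fine (nuab `]-oo, x]%classic)).
    by rewrite gE ?(@measurable_itv R)// -hg.
  rewrite /nuab /= /mfrestr/= /mrestr -[RHS]/(fine (F0 x - F0 a)%:E) -nuE//.
  congr (fine (nu _)); apply/seteqP; split => y /=; rewrite !in_itv/=.
    by move=> [-> /andP[->]].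
  by move=> /andP[ay yx]; rewrite yx ay (le_trans yx xb).
apply/negligible_outer_measure; apply: negligibleS aeG => t /= [/andP[at_ tb] nf] [Gt _].
apply: nf.
have -> : f = (fun x => F0 x) - (fun x => K * x).
  by apply/funext => x; rewrite /F0 /= fctE addrK.
apply: derivableB; last by apply: derivableM; [exact: derivable_cst|exact: derivable_id].
have -> : F0 = (fun x => (F0 x - F0 a)) + cst (F0 a).
  by apply/funext => x; rewrite fctE /= subrK.
apply: derivableD; last exact: derivable_cst.
apply: near_eq_derivable Gt; near=> x; apply: GE.
apply/andP; split; near: x.
- by apply: (@cvgr_ge _ _ (nbhs t) _ idfun t) => //; exact: cvg_id.
- by apply: (@cvgr_le _ _ (nbhs t) _ idfun t) => //; exact: cvg_id.
Unshelve. all: by end_near. Qed.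

(** One-dimensional Rademacher theorem. [f t + K * t] is nondecreasing, and its
    Stieltjes measure is dominated by Lebesgue measure; it therefore has a
    density, and is differentiable at the Lebesgue points of that density. *)
Lemma lipschitz_ae_derivable (f : R -> R) (K : R) :
  (forall s t, `|f s - f t| <= K * `|s - t|) ->
  leb_outer [set t | ~ derivable f t 1] = 0%E.
Proof.
move=> fK.
have K0 : 0 <= K.
  by have := fK 1 0; rewrite subr0 normr1 mulr1; exact: le_trans.
apply: (outer_measure_null_bigcup (mu := leb_outer)
  (B := fun n : nat => [set t | - n.+1%:R < t < n.+1%:R /\ ~ derivable f t 1])).
  move=> t nf; exists (Num.truncn `|t|) => //; split => //.
  by rewrite -ltr_norml truncnS_gt.
by move=> n; apply: lipschitz_ae_derivable_itv fK => //; rewrite gtrN.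
Qed.

End LipschitzDifferentiability.

(** * Slopes, Sard lemma and decomposition into pieces *)

Section Slopes.
Context {R : realType}.

(** Differentiability at [t] with derivative [w], with explicit radii. *)
Definition has_slope (V : normedModType R) (f : R -> V) (t : R) (w : V) :=
  forall e, 0 < e -> exists2 r, 0 < r &
    forall s, `|s - t| <= r -> `|f s - f t - (s - t) *: w| <= e * `|s - t|.

Lemma derivable_has_slope (V : normedModType R) (f : R -> V) t :
  derivable f t 1 -> has_slope f t ('D_1 f t).
Proof.
move=> /cvg_ex[l fl]; have -> : 'D_1 f t = l by apply: cvg_lim fl; exact: norm_hausdorff.
move=> e e0; move/cvgrPdist_le : fl => /(_ _ e0)/nbhs_ballP[r/= r0 fr].
exists (r / 2) => [|s st]; first exact: divr_gt0.
have [->|sNt] := eqVneq s t; first by rewrite !subrr scale0r subr0 !normr0 mulr0.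
have st0 : s - t != 0 by rewrite subr_eq0.
have := fr (s - t); rewrite /ball/= sub0r normrN => /(_ _ st0).
rewrite /GRing.scale/= mulr1 subrK => fst.
have -> : f s - f t - (s - t) *: l = (s - t) *: ((s - t)^-1 *: (f s - f t) - l).
  by rewrite scalerBr scalerA divff// scale1r.
rewrite normrZ mulrC ler_wpM2r// distrC fst//.
by rewrite (le_lt_trans st)// ltr_pdivrMr// ltr_pMr// ltr1n.
Qed.

Lemma has_slope_comp_linear (V W : normedModType R) (q : V -> W) (c : R)
    (f : R -> V) (t : R) (w : V) :
  (forall x y, q (x - y) = q x - q y) -> (forall a x, q (a *: x) = a *: q x) ->
  0 < c -> (forall x, `|q x| <= c * `|x|) ->
  has_slope f t w -> has_slope (q \o f) t (q w).
Proof.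
move=> qB qZ c0 qc fw e e0; have [r r0 fr] := fw (e / c) (divr_gt0 e0 c0).
exists r => // s st; rewrite /= -qZ -!qB (le_trans (qc _))//.
by rewrite mulrC -ler_pdivlMr// mulrAC fr.
Qed.

Lemma has_slope_pair (V W : normedModType R) (f : R -> V) (g : R -> W) t v w :
  has_slope f t v -> has_slope g t w -> has_slope (fun s => (f s, g s)) t (v, w).
Proof.
move=> fv gw e e0; have [r r0 fr] := fv e e0; have [r' r'0 gr] := gw e e0.
exists (Num.min r r') => [|s]; first by rewrite lt_min r0.
by rewrite le_min => /andP[sr sr']; rewrite prod_normE ge_max fr// gr.
Qed.

Lemma lipschitz_ae_has_slope (f : R -> R * R) (K : R) :
  (forall s t, `|f s - f t| <= K * `|s - t|) ->
  leb_outer [set t | ~ exists w, has_slope f t w] = 0%E.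
Proof.
move=> fK.
have f1 : leb_outer [set t | ~ derivable (fst \o f) t 1] = 0%E.
  apply: (lipschitz_ae_derivable (K := K)) => s t.
  exact: le_trans (norm_fst_le _) (fK _ _).
have f2 : leb_outer [set t | ~ derivable (snd \o f) t 1] = 0%E.
  apply: (lipschitz_ae_derivable (K := K)) => s t.
  exact: le_trans (norm_snd_le _) (fK _ _).
apply: (outer_measure_null_bigcup (mu := leb_outer)
  (B := bigcup2 [set t | ~ derivable (fst \o f) t 1] [set t | ~ derivable (snd \o f) t 1])).
  rewrite bigcup2E => t /=; apply: contra_notP => /not_orP[/contrapT d1 /contrapT d2].
  exists ('D_1 (fst \o f) t, 'D_1 (snd \o f) t).
  have := has_slope_pair (derivable_has_slope d1) (derivable_has_slope d2).
  by rewrite (_ : (fun s => _) = f)//; apply/funext => s; rewrite /= -surjective_pairing.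
by case=> [|[|i]] /=; [exact: f1|exact: f2|exact: (outer_measure0 leb_outer)].
Qed.

End Slopes.

Section Sard.
Context {R : realType}.

(** Near a point of slope zero [f] contracts lengths by an arbitrarily small
    factor [e]. The scale at which this happens depends on the point; it is made
    uniform on each of the sets [T k], which are closed, and hence can be made
    disjoint without losing measurability. *)
Lemma hausdorff1_image_slope0 (f : R -> R * R) (K : R) :
  (forall s t, `|f s - f t| <= K * `|s - t|) ->
  hausdorff1 (f @` [set t | has_slope f t 0]) = 0%E.
Proof.
move=> fK; have cf := lipschitz_continuous fK.
apply: (outer_measure_null_bigcup (mu := hausdorff1)
  (B := fun n : nat => f @` [set t | - n%:R <= t <= n%:R /\ has_slope f t 0])).
  move=> _ [t ft <-]; exists (Num.bound `|t|) => //; exists t => //; split => //.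
  by rewrite -ler_norml ltW// archi_boundP.
move=> n; apply/eqP; rewrite eq_le outer_measure_ge0 andbT.
apply/lee_addgt0Pr => /= d d0; rewrite add0e.
(* images cost a factor [2 * e] and [- n, n] has length [2 * n]; the [+ 1]
   covers [n = 0] *)
pose e := d / (4 * n%:R + 1).
have n0 : 0 < 4 * n%:R + 1 :> R by rewrite ltr_wpDl// mulr_ge0.
have e0 : 0 < e by rewrite divr_gt0.
pose T (k : nat) : set R := `[- n%:R, n%:R]%classic `&`
  \bigcap_(h in [set h | `|h| <= k.+1%:R^-1]) [set t | `|f (t + h) - f t| <= e * `|h|].
have mT k : measurable (T k).
  apply: measurableI; first exact: measurable_itv.
  apply: measurable_realfun.closed_measurable; apply: closed_bigI => h _.
  apply: (@closed_preimage_continuous R R (fun t => `|f (t + h) - f t|)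
    [set x : R | x <= e * `|h|]%R); last exact: closed_le.
  move=> t; apply: cvg_norm; apply: cvgB; last exact: cf.
  apply: (@cvg_comp _ _ _ (fun t => t + h) f _ (nbhs (t + h))); last exact: cf.
  by apply: cvgD; [exact: cvg_id|exact: cvg_cst].
pose D := seqDU T.
have mD k : measurable (D k).
  by apply: measurableD => //; exact: bigsetU_measurable.
have tD : trivIset setT D by exact: trivIset_seqDU.
have fD : (hausdorff1 (f @` \bigcup_k D k) <=
    (2 * e)%:E * lebesgue_measure (\bigcup_k D k))%E.
  rewrite image_bigcup (le_trans (hausdorff1_sigma_subadditive _))//.
  rewrite measure_bigcup//=; last by move=> i _; exact: mD.
  rewrite [X in (_ <= _ * X)%E](eq_eseriesl (Q := xpredT)); last by move=> i; exact/mem_set.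
  rewrite -nneseriesZl//; apply: lee_nneseries => [i _ _|i _]; first exact: hausdorff1_ge0.
  apply: (hausdorff1_image_le (r := i.+1%:R^-1)) => // s t _ [[_ Tt] _] st.
  by have := Tt _ st; rewrite /= (addrC t) subrK.
have DT : \bigcup_k D k `<=` `[- n%:R, n%:R]%classic.
  by move=> t [k _ [[]]].
apply: le_trans (le_trans fD _).
  apply: le_hausdorff1; apply: image_subset => t /= [tn ft].
  rewrite -seqDU_bigcup_eq; have [r r0 fr] := ft e e0.
  exists (Num.truncn r^-1) => //; split; first by rewrite /= in_itv.
  move=> h /= hr; have := fr (t + h); rewrite addrAC subrr add0r scaler0 subr0; apply.
  rewrite (le_trans hr)// -[r in leRHS]invrK lef_pV2 ?posrE ?invr_gt0//.
  by rewrite ltW// truncnS_gt.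
have lamD : (lebesgue_measure (\bigcup_k D k) <= (2 * n%:R)%:E)%E.
  apply: le_trans (le_outer_measure leb_outer _ _ DT) _.
  suff : (lebesgue_measure (`[(- n%:R)%R, n%:R%R]%classic : set R)
    <= (2 * n%:R)%:E)%E by [].
  rewrite lebesgue_measure_itv /=; case: ifPn => _.
    by rewrite -EFinB lee_fin; set y := n%:R; lra.
  by rewrite lee_fin mulr_ge0.
apply: le_trans (lee_wpmul2l _ lamD) _; first by rewrite lee_fin mulr_ge0 ?ltW.
rewrite -EFinM lee_fin.
have -> : d = e * (4 * n%:R + 1) by rewrite /e divfK// gt_eqF.
by move: e0; set x := e; set y := n%:R; lra.
Qed.

End Sard.

(** The slopes, the scale at which [f] is almost affine and the position are
    discretised; if every slope in [O] failed for some precision, the countably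
    many resulting pieces would all have null image. *)
Lemma slope_pieces {R : realType} (f : R -> R * R) (S : set R) (O : set (R * R)) :
  hausdorff1 (f @` [set t | S t /\ exists2 w, O w & has_slope f t w]) <> 0%E ->
  exists2 w, O w & forall e, 0 < e -> exists P : set R,
    [/\ P `<=` S, exists M, forall t, P t -> `|t| <= M, hausdorff1 (f @` P) <> 0%E &
        forall s t, P s -> P t -> `|f s - f t - (s - t) *: w| <= e * `|s - t|].
Proof.
apply: contra_notP => noslope.
pose d m : R := m.+1%:R^-1; have d0 m : 0 < d m by rewrite invr_gt0.
pose bad m w := forall P : set R, P `<=` S -> (exists M, forall t, P t -> `|t| <= M) ->
  (forall s t, P s -> P t -> `|f s - f t - (s - t) *: w| <= d m * `|s - t|) ->
  hausdorff1 (f @` P) = 0%E.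
have dsmall e : 0 < e -> exists m, d m <= e.
  move=> e0; exists (Num.truncn e^-1).
  by rewrite -[leRHS]invrK lef_pV2 ?posrE ?invr_gt0// ltW// truncnS_gt.
have badP w : O w -> exists m, bad m w.
  move=> Ow; apply: contra_notP noslope => nobad; exists w => // e e0.
  have [m me] := dsmall e e0.
  move/forallNP : nobad => /(_ m)/existsNP[P /not_implyP[PS /not_implyP[Pb]]].
  move=> /not_implyP[Paff fP]; exists P; split => // s t Ps Pt.
  by rewrite (le_trans (Paff _ _ Ps Pt))// ler_wpM2r.
(* the error on a piece is the sum of two of relative size at most [d m / 4]:
   that of the slope at the second point, and its distance to the slope [w0] of
   a reference point of the piece *)
have d40 m : 0 < d m / 4 by rewrite divr_gt0.
have [J JP] := choice (fun m => mesh (d40 m)).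
have [I IP] := choice (fun m => mesh (d0 m)).
pose piece (i : nat * nat * nat * nat * nat) : set R :=
  let: (m, k, a, b, l) := i in
  [set t | S t /\ I k l t /\ exists w, [/\ bad m w, J m a w.1, J m b w.2 &
     forall s, `|s - t| <= d k -> `|f s - f t - (s - t) *: w| <= d m / 4 * `|s - t|]].
have piece0 i : hausdorff1 (f @` piece i) = 0%E.
  case: i => [[[[m k] a] b] l].
  have [->|/set0P[t0 [St0 [It0 [w0 [badw0 a0 b0 _]]]]]] :=
    eqVneq (piece (m, k, a, b, l)) set0.
    by rewrite image_set0 hausdorff10.
  have [_ _ _ Idiam _] := IP k; have [_ _ _ Jdiam _] := JP m.
  apply: badw0 => [t []//||].
    exists (`|t0| + d k) => t [_ [It _]]; rewrite -lerBlDl.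
    by rewrite (le_trans (lerB_dist _ _))// ltW// (Idiam _ _ _ It It0).
  move=> s t [_ [Is _]] [_ [It [w [_ wa wb fw]]]].
  have -> : f s - f t - (s - t) *: w0 = (f s - f t - (s - t) *: w) + (s - t) *: (w - w0).
    by rewrite scalerBr addrA subrK.
  have ww0 : `|w - w0| <= d m / 4.
    by rewrite norm_pairE ge_max (ltW (Jdiam _ _ _ wa a0)) (ltW (Jdiam _ _ _ wb b0)).
  rewrite (le_trans (ler_normD _ _))// normrZ.
  have := fw s (ltW (Idiam _ _ _ Is It)); have := normr_ge0 (s - t); have := d0 m.
  by move: (d m) ww0 => x; nra.
pose B i := if unpickle i is Some j then piece j else set0.
apply: (outer_measure_null_bigcup (mu := hausdorff1) (B := fun i => f @` B i)); last first.
  move=> i; rewrite /B; case: unpickle => [j|]; first exact: piece0.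
  by rewrite image_set0; exact: hausdorff10.
rewrite -image_bigcup; apply: image_subset => t /= [St [w Ow fw]].
have [m badm] := badP w Ow.
have [r r0 fr] := fw _ (d40 m); have [k kr] := dsmall r r0.
have [_ _ JT _ _] := JP m; have [_ _ IT _ _] := IP k.
have [a _ wa] : (\bigcup_i J m i) w.1 by rewrite JT.
have [b _ wb] : (\bigcup_i J m i) w.2 by rewrite JT.
have [l _ tl] : (\bigcup_i I k i) t by rewrite IT.
have [i iE] : exists i, unpickle i = Some (m, k, a, b, l).
  by exists (pickle (m, k, a, b, l)); rewrite pickleK.
exists i => //; rewrite /B iE; split => //; split => //; exists w; split => // s sk.
by apply: fr; exact: le_trans kr.
Qed.

(** * Lipschitz parametrization of a rectifiable curve *)

Section CurveParametrization.
Context {R : realType}.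

(** McShane extension, along a reparametrization [l] that need not be injective. *)
Lemma mcshane_extension (A : set R) (x l : R -> R) : A !=set0 ->
  (forall s t, A s -> A t -> `|x s - x t| <= `|l s - l t|) ->
  exists2 g : R -> R, (forall r r', `|g r - g r'| <= `|r - r'|) &
    forall t, A t -> g (l t) = x t.
Proof.
move=> [t0 At0] xl.
pose V r := [set x t + `|r - l t| | t in A].
have lbV r t : A t -> lbound (V r) (x t - `|r - l t|).
  move=> At _ [s As <-].
  have := xl _ _ At As; have := ler_norm (x t - x s).
  have := ler_distD r (l t) (l s); rewrite (distrC (l t) r); lra.
have hasV r : has_inf (V r).
  split; first by exists (x t0 + `|r - l t0|); exists t0.
  by exists (x t0 - `|r - l t0|); exact: lbV.
pose g r := inf (V r).
have gle r t : A t -> g r <= x t + `|r - l t|.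
  by move=> At; apply: ge_inf; [exact: (hasV r).2|exists t].
have glip r r' : g r <= g r' + `|r - r'|.
  rewrite -lerBlDr; apply: lb_le_inf; first exact: (hasV r').1.
  move=> _ [t At <-]; have := gle r t At; have := ler_distD r' r (l t); lra.
exists g => [r r'|t At].
  have := glip r r'; have := glip r' r; rewrite (distrC r' r) ler_norml; lra.
apply/eqP; rewrite eq_le; apply/andP; split.
  by have := gle (l t) t At; rewrite subrr normr0 addr0.
apply: lb_le_inf; first exact: (hasV (l t)).1.
by have := lbV (l t) t At; rewrite subrr normr0 subr0.
Qed.

Lemma rectifiable_bounded_variation (a b : R) (gamma : R -> R * R) (q : R * R -> R) :
  (forall p, `|q p| <= enorm p) -> (forall p p', q (p - p') = q p - q p') ->
  rectifiable_path a b gamma -> bounded_variation a b (q \o gamma).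
Proof.
move=> qe qB [M Mub]; exists M => _ [s abs <-].
apply: (@le_trans _ _ (polygonal_length a b gamma s)); last by apply: Mub; exists s.
rewrite /variation /polygonal_length; apply: ler_sum => i _ /=.
by rewrite -qB; exact: qe.
Qed.

Let total_variation_increment (a b : R) (x : R -> R) (s t : R) :
  bounded_variation a b x -> a <= s -> s <= t -> t <= b ->
  `|x t - x s| <= fine (total_variation a t x) - fine (total_variation a s x).
Proof.
move=> bvx as_ st tb.
have fin u v : a <= u -> u <= v -> v <= b -> total_variation u v x \is a fin_num.
  move=> au uv vb; apply/bounded_variationP => //.
  exact: bounded_variationr au uv (bounded_variationl (le_trans au uv) vb bvx).
rewrite (total_variationD x as_ st) fineD ?fin// ?(le_trans st)//.
by rewrite addrAC subrr add0r -lee_fin fineK ?fin// total_variation_ge.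
Qed.

(** The parameter of a point is the sum of the variations of the two coordinates
    up to that point. Jumps of this parameter are harmless, because
    [g] is extended over the gaps. *)
Lemma rectifiable_path_lipschitz (a b : R) (gamma : R -> R * R) : a <= b ->
  rectifiable_path a b gamma ->
  exists g : R -> R * R, (forall r r', `|g r - g r'| <= `|r - r'|) /\
    exists l : R -> R, forall t, a <= t <= b -> g (l t) = gamma t.
Proof.
move=> ab rect.
have bv1 : bounded_variation a b (fst \o gamma).
  apply: (rectifiable_bounded_variation _ _ rect) => // p.
  exact: le_trans (norm_fst_le p) (norm_le_enorm p).
have bv2 : bounded_variation a b (snd \o gamma).
  apply: (rectifiable_bounded_variation _ _ rect) => // p.
  exact: le_trans (norm_snd_le p) (norm_le_enorm p).
pose l t := fine (total_variation a t (fst \o gamma)) +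
            fine (total_variation a t (snd \o gamma)).
have lP s t : a <= s -> s <= t -> t <= b ->
    `|(gamma t).1 - (gamma s).1| <= l t - l s /\
    `|(gamma t).2 - (gamma s).2| <= l t - l s.
  move=> as_ st tb.
  have /= v1 := total_variation_increment bv1 as_ st tb.
  have /= v2 := total_variation_increment bv2 as_ st tb.
  have := normr_ge0 ((gamma t).1 - (gamma s).1).
  have := normr_ge0 ((gamma t).2 - (gamma s).2).
  by rewrite /l; split; lra.
have lP' s t : a <= s <= b -> a <= t <= b ->
    `|(gamma s).1 - (gamma t).1| <= `|l s - l t| /\
    `|(gamma s).2 - (gamma t).2| <= `|l s - l t|.
  move=> /andP[as_ sb] /andP[at_ tb].
  have [st|/ltW ts] := leP s t.
    rewrite distrC (distrC (gamma s).2) (distrC (l s)).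
    by have [l1 l2] := lP _ _ as_ st tb; split; apply: le_trans (ler_norm _).
  by have [l1 l2] := lP _ _ at_ ts sb; split; apply: le_trans (ler_norm _).
have A0 : [set t | a <= t <= b] !=set0 by exists a; rewrite /= lexx.
have [g1 g1lip g1l] := mcshane_extension A0 (fun s t as_ at_ => (lP' s t as_ at_).1).
have [g2 g2lip g2l] := mcshane_extension A0 (fun s t as_ at_ => (lP' s t as_ at_).2).
exists (fun r => (g1 r, g2 r)); split.
  by move=> r r'; rewrite norm_pairE ge_max g1lip g2lip.
by exists l => t abt; rewrite g1l// g2l// -surjective_pairing.
Qed.

End CurveParametrization.

(** * Borel hulls and Caratheodory measurable sets *)

Section BorelHull.
Context {R : realType}.

(** The covering sets may be replaced by their closures, which have the same
    diameter; intersecting the unions of better and better coverings gives a hull. *)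
Lemma hausdorff1_hull (S : set (R * R)) : (hausdorff1 S < +oo)%E ->
  exists V : nat -> nat -> set (R * R), [/\ forall k i, closed (V k i),
    S `<=` \bigcap_k \bigcup_i V k i &
    (hausdorff1 (\bigcap_k \bigcup_i V k i) <= hausdorff1 S)%E].
Proof.
move=> Sfin.
pose d k : R := k.+1%:R^-1; have d0 k : 0 < d k by rewrite invr_gt0.
have Sfinnum : hausdorff1 S \is a fin_num by rewrite ge0_fin_numE ?hausdorff1_ge0.
have /choice[U UP] k : exists U : nat -> set (R * R), [/\ S `<=` \bigcup_i U i,
    forall i, (ediam (U i) <= (d k)%:E)%E &
    (\sum_(0 <= i <oo) ediam (U i) <= hausdorff1 S + (d k)%:E)%E].
  have : (hausdorff1_delta (d k) S < hausdorff1 S + (d k)%:E)%E.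
    apply: le_lt_trans (hausdorff1_ge_delta S (d0 k)) _.
    by rewrite lteDl// lte_fin.
  by move=> /ereal_inf_lt[_ [U [SU Ud] <-] /ltW ?]; exists U.
exists (fun k i => closure (U k i)); split.
- by move=> k i; exact: closed_closure.
- move=> z Sz k _; have [SU _ _] := UP k; have [i _ Uz] := SU z Sz.
  by exists i => //; exact: subset_closure.
apply: hausdorff1_lub => r r0; apply/lee_addgt0Pr => e e0.
have [k kre] : exists k, d k <= Num.min r e.
  have m0 : 0 < Num.min r e by rewrite lt_min r0.
  exists (Num.truncn (Num.min r e)^-1).
  by rewrite -[leRHS]invrK lef_pV2 ?posrE ?invr_gt0// ltW// truncnS_gt.
move: kre; rewrite le_min => /andP[kr ke].
have [_ Ud Usum] := UP k.
apply: (@le_trans _ _ (hausdorff1_delta r (\bigcup_i closure (U k i)))).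
  by apply: le_hausdorff1_delta; exact: bigcap_inf.
apply: (@le_trans _ _ (\sum_(0 <= i <oo) ediam (closure (U k i)))%E).
  apply: hausdorff1_delta_le_cover => // i; rewrite ediam_closure.
  by rewrite (le_trans (Ud i))// lee_fin.
rewrite (eq_eseriesr (g := fun i => ediam (U k i))); last first.
  by move=> i _; rewrite ediam_closure.
by rewrite (le_trans Usum)// leeD2l// lee_fin.
Qed.

(** The preimage of [A] need not be measurable. Removing from [Q := closure P] the
    preimage of a Borel hull of [f Q \ A] leaves a Borel subset of it, and what
    is lost has null image: the part of the hull in [f Q] meets [A] in a null set,
    because [A] splits the measure of that part additively. *)
Lemma caratheodory_preimage_compact (f : R -> R * R) (K : R) (A : set (R * R)) (P : set R) :
  (forall s t, `|f s - f t| <= K * `|s - t|) -> hausdorff1.-caratheodory A ->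
  (exists M, forall t, P t -> `|t| <= M) -> f @` P `<=` A ->
  hausdorff1 (f @` P) <> 0%E ->
  exists C, [/\ compact C, C `<=` closure P, f @` C `<=` A & (0 < lebesgue_measure C)%E].
Proof.
move=> fK cA [M PM] fPA fP; have cf := lipschitz_continuous fK.
pose Q := closure P.
have QM : Q `<=` `[- M, M]%classic.
  have /closure_id -> : closed (`[- M, M]%classic : set R) by exact: itv_closed.
  by apply: closureS => t /PM; rewrite /= in_itv/= ler_norml.
have cQ : compact Q.
  by apply: (subclosed_compact _ _ QM); [exact: closed_closure|exact: segment_compact].
have mQ : measurable Q by exact: measurable_realfun.closed_measurable (@closed_closure _ P).
have PQ : f @` P `<=` f @` Q by apply: image_subset; exact: subset_closure.
have K0 : 0 < `|K| + 1 by rewrite ltr_wpDl.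
have fK' s t : `|f s - f t| <= (`|K| + 1) * `|s - t|.
  by rewrite (le_trans (fK s t))// ler_wpM2r// (le_trans (ler_norm K))// lerDl.
have fQfin : (hausdorff1 (f @` Q) < +oo)%E.
  apply: le_lt_trans (hausdorff1_image_le (K := `|K| + 1) (r := 1) mQ K0 ltr01 _) _ => //.
  by rewrite lte_mul_pinfty ?lee_fin ?mulr_ge0 ?ltW// compact_finite_measure.
have [V [cV SV VS]] :=
  hausdorff1_hull (le_lt_trans (le_hausdorff1 (@subDsetl _ (f @` Q) A)) fQfin).
set B := \bigcap_k \bigcup_i V k i in SV VS.
have mfB : measurable (f @^-1` B).
  rewrite preimage_bigcap; apply: bigcapT_measurable => k.
  rewrite preimage_bigcup; apply: bigcupT_measurable => i.
  apply: measurable_realfun.closed_measurable.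
  exact: closed_preimage_continuous cf (cV k i).
pose C0 := Q `\` f @^-1` B.
have mC0 : measurable C0 by exact: measurableD.
have C0A : f @` C0 `<=` A.
  move=> _ [t [Qt nB] <-]; apply: contrapT => nA; apply: nB; apply: SV.
  by split => //; exists t.
have XA0 : hausdorff1 (B `&` f @` Q `&` A) = 0%E.
  have Sfin : hausdorff1 (f @` Q `\` A) \is a fin_num.
    rewrite ge0_fin_numE ?hausdorff1_ge0// (le_lt_trans _ fQfin)//.
    by apply: le_hausdorff1; exact: subDsetl.
  have Sle : (hausdorff1 (f @` Q `\` A) <= hausdorff1 (B `&` f @` Q `&` ~` A))%E.
    by apply: le_hausdorff1 => z [fQz nAz]; split => //; split => //; apply: SV.
  have Xle : (hausdorff1 (B `&` f @` Q) <= hausdorff1 (f @` Q `\` A))%E.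
    by apply: le_trans VS; apply: le_hausdorff1; exact: subIsetl.
  apply/eqP; rewrite eq_le hausdorff1_ge0 andbT.
  rewrite -(leeD2rE _ _ Sfin) add0e; apply: le_trans Xle.
  by rewrite [leRHS](cA (B `&` f @` Q)) leeD2l.
have C0pos : (0 < lebesgue_measure C0)%E.
  rewrite lt0e measure_ge0 andbT; apply/eqP => C00; apply: fP.
  apply: (outer_measure_null_bigcup (mu := hausdorff1)
    (B := bigcup2 (f @` C0) (B `&` f @` Q `&` A))).
    rewrite bigcup2E => _ [t Pt <-].
    have Qt : Q t by exact: subset_closure.
    have [Bt|nBt] := pselect (B (f t)); [right|left]; last by exists t.
    by split; [split => //; exists t|apply: fPA; exists t].
  case=> [|[|i]] /=; [|exact: XA0|exact: hausdorff10].
  exact: hausdorff1_image_null fK C00.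
have C0fin : (lebesgue_measure C0 < +oo)%E.
  apply: (@le_lt_trans _ _ (lebesgue_measure Q)); last exact: compact_finite_measure.
  by apply: (le_outer_measure leb_outer); exact: subDsetl.
pose e := fine (lebesgue_measure C0).
have e0 : 0 < e by rewrite fine_gt0// C0pos.
have [C [cC CC0 C0C]] := lebesgue_regularity_inner mC0 C0fin e0.
exists C; split => //.
- by move=> t /CC0[].
- by apply: subset_trans C0A; exact: image_subset.
rewrite lt0e measure_ge0 andbT; apply/eqP => C00; move: C0C; rewrite ltNge => /negP; apply.
rewrite /e fineK ?ge0_fin_numE//.
suff : (leb_outer C0 <= leb_outer C + leb_outer (C0 `\` C))%E.
  by rewrite [leb_outer C]C00 add0e.
apply: le_trans (outer_measureU2 leb_outer C (C0 `\` C)).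
apply: (le_outer_measure leb_outer) => t Ct.
by have [?|?] := pselect (C t); [left|right].
Qed.

End BorelHull.

(** * Area of the image under an expanding map *)

Section ExpandingImages.
Context {R : realType}.
Local Notation lam := (@lebesgue_measure R).

Let lam2 : {measure set (measurableTypeR R * measurableTypeR R) -> \bar R} :=
  (lam \x lam)%E.

Let planar_box (A B : set R) : measurable A -> measurable B ->
  lam2 (A `*` B) = (lam A * lam B)%E.
Proof. by move=> mA mB; exact: product_measure1E. Qed.

(** The half-open squares of a square grid of side [h] that meet [K]. *)
Let grid_hull (h : R) (K : set (R * R)) : 0 < h -> exists cell : nat -> set (R * R),
  [/\ forall i, measurable (cell i), trivIset setT cell, K `<=` \bigcup_i cell i,
      forall i z z', cell i z -> cell i z' -> `|z - z'| < h &
      forall i, cell i !=set0 -> (cell i `&` K !=set0 /\ lam2 (cell i) = (h ^+ 2)%:E)].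
Proof.
move=> h0; have [J [mJ tJ JT Jh lamJ]] := mesh h0.
pose sq (ab : nat * nat) := J ab.1 `*` J ab.2.
pose cell i : set (R * R) := if pickle_inv i is Some ab then
  if pselect (sq ab `&` K !=set0) then sq ab else set0 else set0.
have cellP i z : cell i z -> exists ab,
    [/\ pickle_inv i = Some ab, sq ab z, cell i = sq ab & sq ab `&` K !=set0].
  rewrite /cell; case: (pickle_inv i) => [ab|//].
  by case: pselect => [sqK|nsqK] //= sqz; exists ab.
exists cell; split.
- move=> i; rewrite /cell; case: (pickle_inv i) => [ab|]; last exact: measurable0.
  by case: pselect => [?|?] /=; [exact: measurableX|exact: measurable0].
- move=> i j _ _ [z [/cellP[[a b] [iab [/= Ja Jb] _ _]]]].
  move=> /cellP[[a' b'] [jab [/= Ja' Jb'] _ _]].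
  have aa' : a = a' by apply: (tJ a a') => //; exists z.1.
  have bb' : b = b' by apply: (tJ b b') => //; exists z.2.
  have inj := @pickle_invK (nat * nat)%type.
  by have := inj i; have := inj j; rewrite iab jab aa' bb' /= => -> ->.
- move=> z Kz.
  have [a _ Ja] : (\bigcup_i J i) z.1 by rewrite JT.
  have [b _ Jb] : (\bigcup_i J i) z.2 by rewrite JT.
  have [i iE] : exists i, pickle_inv i = Some (a, b).
    by exists (pickle (a, b)); rewrite pickleK_inv.
  exists i => //; rewrite /cell iE; case: pselect => [?|nK] //=.
  by apply: nK; exists z.
- move=> i z z' cz; have [ab [_ [z1 z2] -> _] [z'1 z'2]] := cellP i z cz.
  by rewrite norm_pairE gt_max (Jh _ _ _ z1 z'1) (Jh _ _ _ z2 z'2).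
- move=> i [z /cellP[ab [_ [z1 z2] -> sqK]]]; split => //.
  rewrite planar_box// expr2 EFinM.
  by congr (_ * _)%E; apply: lamJ; [exists z.1|exists z.2].
Qed.

Let le_planar (A B : set (R * R)) : measurable A -> measurable B ->
  A `<=` B -> (lam2 A <= lam2 B)%E.
Proof.
by move=> mA mB AB; apply: (@le_measure _ _ _ lam2) => //; exact/mem_set.
Qed.

Let box (p : R * R) (r : R) : set (R * R) :=
  `[p.1 - r, p.1 + r]%classic `*` `[p.2 - r, p.2 + r]%classic.

Let measurable_box p r : measurable (box p r).
Proof. by apply: measurableX; exact: measurable_itv. Qed.

Let planar_square (p : R * R) (r : R) : 0 <= r -> lam2 (box p r) = ((2 * r) ^+ 2)%:E.
Proof.
move=> r0; rewrite planar_box; [|exact: measurable_itv|exact: measurable_itv].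
have side (x : R) : lam `[x - r, x + r]%classic = (2 * r)%:E.
  rewrite lebesgue_measure_itv /= lte_fin; case: ltP => [_|xr].
    by rewrite -EFinB; congr EFin; lra.
  by have r00 : r = 0; [lra|rewrite r00 mulr0].
by rewrite !side -EFinM expr2.
Qed.

Let boxE (p : R * R) (r : R) z : box p r z <-> `|z - p| <= r.
Proof.
rewrite /box /= !in_itv /= norm_pairE ge_max !ler_distl.
by split => [[-> ->]|/andP[-> ->]].
Qed.

(** Each cell of a grid of mesh [h] meeting the image pulls back into a square of
    side [2 * h / c], so the cells have total area at least a fixed multiple of
    the area of the source, whereas their area tends to that of the image as [h]
    tends to zero. *)
Lemma expanding_image_pos (C U : set R) (F : R * R -> R * R) (c : R) : 0 < c ->
  compact C -> compact U -> (0 < lam C)%E -> (0 < lam U)%E ->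
  compact (F @` (C `*` U)) ->
  (forall p p', (C `*` U) p -> (C `*` U) p' -> c * `|p - p'| <= `|F p - F p'|) ->
  (0 < planar_lebesgue (F @` (C `*` U)))%E.
Proof.
rewrite -[planar_lebesgue]/(lam2 : set (R * R) -> \bar R).
move=> c0 cC cU C0 U0; set K := F @` _ => cK Fc.
have mC : measurable C by exact: measurable_realfun.compact_measurable.
have mU : measurable U by exact: measurable_realfun.compact_measurable.
have mCU : measurable (C `*` U) by exact: measurableX.
pose h n : R := n.+1%:R^-1; have h0 n : 0 < h n by rewrite invr_gt0.
have [cell cellP] := choice (fun n => grid_hull K (h0 n)).
pose N n := \bigcup_i cell n i.
have mN n : measurable (N n) by apply: bigcupT_measurable => i; have [] := cellP n.
have Narea n : (lam2 (C `*` U) <= ((2 / c) ^+ 2)%:E * lam2 (N n))%E.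
  have [mc tc Kc dc ac] := cellP n.
  have c20 : 0 <= (2 / c) ^+ 2 by rewrite sqr_ge0.
  rewrite measure_bigcup//=; last by move=> i _; exact: mc.
  rewrite [X in (_ <= _ * X)%E](eq_eseriesl (Q := xpredT)); last by move=> i; exact/mem_set.
  rewrite -nneseriesZl//.
  have /choice[B BP] i : exists B, [/\ measurable B,
      (C `*` U) `&` F @^-1` (cell n i) `<=` B &
      lam2 B = (((2 / c) ^+ 2)%:E * lam2 (cell n i))%E].
    have [ci0|/set0P ci] := eqVneq (cell n i) set0.
      by exists set0; rewrite ci0 !measure0 mule0; split => // p [].
    have [[z [cz [p CUp Fp]]] area] := ac i ci.
    exists (box p (h n / c)); split => //.
      move=> p' [CUp' Fp']; apply/boxE; rewrite distrC ler_pdivlMr// mulrC.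
      rewrite (le_trans (Fc _ _ CUp CUp'))// ltW//.
      by apply: (dc i) => //; rewrite Fp.
    rewrite planar_square; last by rewrite divr_ge0 ?ltW.
    by rewrite area -EFinM -exprMn; congr (_ ^+ 2)%:E; rewrite mulrA mulrAC.
  apply: (@le_trans _ _ (\sum_(i <oo) lam2 (B i))%E); last first.
    apply: lee_nneseries => [i _ _|i _]; first exact: measure_ge0.
    by have [_ _ ->] := BP i.
  apply: measure_sigma_subadditive => //; first by move=> i; have [] := BP i.
  move=> p CUp; have [i _ ci] := Kc (F p) (ex_intro2 _ _ p CUp erefl).
  by exists i => //; have [_ + _] := BP i; apply.
(* the grids need not be nested: tails of their unions make a decreasing family *)
pose V n := \bigcup_(m in [set m | (n <= m)%N]) N m.
have mV n : measurable (V n) by apply: bigcup_measurable => m _.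
have NV n : N n `<=` V n by move=> z Nz; exists n => //=.
have Vnear n z : V n z -> exists2 k, K k & `|k - z| < h n.
  move=> [m /= nm [i _ ciz]]; have [_ _ _ dc ac] := cellP m.
  have [[k [cik Kk]] _] := ac i (ex_intro _ z ciz).
  exists k => //; apply: lt_le_trans (dc _ _ _ cik ciz) _.
  by rewrite /h lef_pV2 ?posrE// ler_nat.
have VK : \bigcap_n V n = K.
  apply/seteqP; split => [z Vz|z Kz n _]; last first.
    by apply: NV; have [_ _ Kc _ _] := cellP n; exact: Kc.
  have /closure_id -> : closed K by apply: compact_closed cK; exact: norm_hausdorff.
  move=> W /nbhs_ballP[e /= e0 We].
  have [n ne] : exists n, h n <= e.
    exists (Num.truncn e^-1).
    by rewrite -[leRHS]invrK lef_pV2 ?posrE ?invr_gt0// ltW// truncnS_gt.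
  have [k Kk kz] := Vnear n z (Vz n Logic.I).
  exists k; split => //; apply: We; rewrite -ball_normE /= distrC.
  exact: lt_le_trans ne.
have mK : measurable K by rewrite -VK; exact: bigcapT_measurable.
have [M KM] : exists M, forall k, K k -> `|k| <= M.
  have [M [_ MK]] := compact_bounded cK.
  by exists (M + 1) => k Kk; apply: MK => //; rewrite ltrDl.
have V0fin : (lam2 (V 0%N) < +oo)%E.
  pose r := `|M| + 1.
  have r0 : 0 <= r by rewrite addr_ge0.
  apply: (@le_lt_trans _ _ (lam2 (box 0 r))); last by rewrite planar_square// ltry.
  apply: le_planar => // z /Vnear[k Kk kz]; apply/boxE; rewrite subr0.
  have -> : z = k - (k - z) by rewrite opprB addrC subrK.
  rewrite (le_trans (ler_normB _ _))// lerD//.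
    by rewrite (le_trans (KM _ Kk))// ler_norm.
  by rewrite (le_trans (ltW kz))// /h invr1.
have Vlim : lam2 (V n) @[n --> \oo] --> lam2 K.
  rewrite -VK; apply: nonincreasing_cvg_mu => //; first exact: bigcapT_measurable.
  move=> n m nm; apply/subsetPset => z [k /= mk Nz]; exists k => //=.
  exact: leq_trans mk.
have d0 : 0 < ((2 / c) ^+ 2)^-1 by rewrite invr_gt0 exprn_gt0// divr_gt0.
rewrite lt_neqAle measure_ge0 andbT eq_sym; apply/eqP => K0.
have : (((2 / c) ^+ 2)^-1%:E * lam2 (C `*` U) <= lam2 K)%E.
  rewrite -(cvg_lim _ Vlim)//; apply: lime_ge; first by apply/cvg_ex; exists (lam2 K).
  near=> n; rewrite lee_pdivrMl ?exprn_gt0 ?divr_gt0//.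
  apply: le_trans (Narea n) _; apply: lee_wpmul2l; first by rewrite lee_fin sqr_ge0.
  exact: le_planar.
by apply/negP; rewrite -ltNge K0 mule_gt0 ?lte_fin// planar_box// mule_gt0.
Unshelve. all: by end_near. Qed.

End ExpandingImages.

(** * Sums of transversal almost affine pieces *)

Section AlmostAffine.
Context {R : realType}.
Implicit Types (f g : R -> R * R) (P C U : set R) (w v : R * R).

(** A uniform version of differentiability on [P], with the same slope for all
    pairs of points: the chords of [f] over [P] are nearly multiples of [w]. *)
Definition almost_affine f P w (e : R) :=
  forall s t, P s -> P t -> `|f s - f t - (s - t) *: w| <= e * `|s - t|.

Lemma almost_affine_sub f P C w e :
  C `<=` P -> almost_affine f P w e -> almost_affine f C w e.
Proof. by move=> CP fP s t Cs Ct; apply: fP; exact: CP. Qed.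

Lemma almost_affine_closure f P w e : continuous f ->
  almost_affine f P w e -> almost_affine f (closure P) w e.
Proof.
move=> cf fP.
pose D s := [set t | `|f s - f t - (s - t) *: w| - e * `|s - t| <= 0].
have cD s : closed (D s).
  apply: (@closed_preimage_continuous R R
    (fun t => `|f s - f t - (s - t) *: w| - e * `|s - t|) [set x : R | x <= 0]);
    last exact: closed_le.
  have cst_id t : (fun t => s - t) @ t --> s - t.
    by apply: cvgB; [exact: cvg_cst|exact: cvg_id].
  move=> t; apply: cvgB.
    apply: cvg_norm; apply: cvgB; last exact: (cvgZr_tmp (cst_id t)).
    by apply: cvgB; [exact: cvg_cst|exact: cf].
  by apply: cvgM; [exact: cvg_cst|apply: cvg_norm; exact: cst_id].
have sym s t : D s t -> D t s.
  rewrite /D /= (distrC t s).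
  have -> : f t - f s - (t - s) *: w = - (f s - f t - (s - t) *: w).
    by rewrite -(opprB s t) scaleNr opprK [RHS]opprB opprB addrC.
  by rewrite normrN.
have half s t : P s -> closure P t -> D s t.
  move=> Ps clt; apply: (cD s); apply: closureS clt => u Pu.
  by rewrite /D /= subr_le0; exact: fP.
move=> s t cls clt; rewrite -subr_le0; apply: (cD s); apply: closureS clt => u Pu.
by apply: sym; exact: half.
Qed.

Lemma almost_affineN f P w e : almost_affine f P w e -> almost_affine (\- f) P (- w) e.
Proof.
move=> fP s t Ps Pt; rewrite -normrN.
have -> : - ((\- f) s - (\- f) t - (s - t) *: (- w)) = f s - f t - (s - t) *: w.
  by rewrite /= scalerN -!opprD opprK.
exact: fP.
Qed.

Definition det2 w v : R := w.1 * v.2 - w.2 * v.1.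

Lemma det2B w x y : det2 w (x - y) = det2 w x - det2 w y.
Proof. by rewrite /det2 /=; ring. Qed.

Lemma det2Z w a x : det2 w (a *: x) = a *: det2 w x.
Proof. by rewrite /det2 /= /GRing.scale /=; ring. Qed.

Lemma det2_le w v : `|det2 w v| <= 2 * `|w| * `|v|.
Proof.
rewrite /det2 (le_trans (ler_normB _ _))// !normrM mulr2n !mulrDl mul1r.
by rewrite lerD// ler_pM// ?norm_fst_le ?norm_snd_le.
Qed.

Lemma det2_eq0 w v : w != 0 -> det2 w v = 0 -> exists c, v = c *: w.
Proof.
move=> w0 /eqP; rewrite subr_eq0 => /eqP wv.
have [w10|w10] := eqVneq w.1 0.
  have w20 : w.2 != 0.
    by apply: contra_neq w0 => w20; rewrite [w]surjective_pairing w10 w20.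
  exists (v.2 / w.2); rewrite [LHS]surjective_pairing; congr (_, _) => /=.
    apply/eqP; move/eqP: wv; rewrite w10 mul0r eq_sym mulf_eq0 (negbTE w20) /=.
    by move=> /eqP ->; rewrite /GRing.scale/= mulr0.
  by rewrite /GRing.scale/= divfK.
exists (v.1 / w.1); rewrite [LHS]surjective_pairing; congr (_, _) => /=.
  by rewrite /GRing.scale/= divfK.
by rewrite /GRing.scale/= mulrAC (mulrC v.1) -wv mulrAC divff// mul1r.
Qed.

Lemma det2_continuous w : continuous (det2 w).
Proof.
move=> z; apply: cvgB; apply: cvgM;
  by [exact: cvg_cst|exact: cvg_fst|exact: cvg_snd].
Qed.

(** For independent [w] and [v] this is half the factor by which Cramer's rule
    shows [(s, u) |-> s *: w + u *: v] to expand distances; an error of at most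
    this relative size leaves the other half. *)
Definition transversality w v : R := `|det2 w v| / (4 * (`|w| + `|v|)).

Lemma transversality_gt0 w v : det2 w v != 0 -> 0 < transversality w v.
Proof.
move=> wv; rewrite divr_gt0 ?normr_gt0// mulr_gt0//.
have w0 : `|w| != 0.
  apply: contra_neq wv => /eqP; rewrite normr_eq0 => /eqP ->.
  by rewrite /det2 /= !mul0r subrr.
by rewrite ltr_pwDl// lt0r w0/=.
Qed.

Lemma transversalityN w v : transversality w (- v) = transversality w v.
Proof.
by rewrite /transversality normrN -sub0r det2B {1}/det2 /= !mulr0 subrr sub0r normrN.
Qed.

Lemma transversal_expanding w v (a b : R) : det2 w v != 0 ->
  2 * transversality w v * (`|a| + `|b|) <= `|a *: w + b *: v|.
Proof.
move=> wv; have t0 := transversality_gt0 wv; set x := a *: w + b *: v.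
have wv0 : 0 < `|w| + `|v|.
  rewrite lt0r addr_ge0// andbT; apply: contraTneq t0.
  by rewrite /transversality => ->; rewrite mulr0 invr0 mulr0 ltxx.
have xv : a * det2 w v = det2 x v by rewrite /x /det2 /= /GRing.scale /=; ring.
have xw : b * det2 w v = det2 w x by rewrite /x /det2 /= /GRing.scale /=; ring.
have : (`|a| + `|b|) * `|det2 w v| <= 2 * (`|w| + `|v|) * `|x|.
  rewrite mulrDl -!normrM xv xw.
  by have := det2_le x v; have := det2_le w x; lra.
rewrite -ler_pdivrMl ?mulr_gt0// => /(le_trans _); apply.
rewrite /transversality le_eqVlt; apply/orP; left; apply/eqP.
by field; rewrite gt_eqF.
Qed.

Definition sum_map f g (p : R * R) : R * R := f p.1 + g p.2.

(** The errors of the two pieces together consume at most half of the expansion of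
    the linear map with columns [w] and [v]. *)
Lemma sum_of_transversal_pieces f g C U w v e :
  continuous f -> continuous g -> compact C -> compact U ->
  (0 < @lebesgue_measure R C)%E -> (0 < @lebesgue_measure R U)%E ->
  det2 w v != 0 -> e <= transversality w v ->
  almost_affine f C w e -> almost_affine g U v e ->
  compact (sum_map f g @` (C `*` U)) /\
  (0 < planar_lebesgue (sum_map f g @` (C `*` U)))%E.
Proof.
move=> cf cg cC cU C0 U0 wv ewv fC gU.
have cF : continuous (sum_map f g).
  move=> p; apply: cvgD.
    by apply: (@continuous_comp _ _ _ fst f); [exact: cvg_fst|exact: cf].
  by apply: (@continuous_comp _ _ _ snd g); [exact: cvg_snd|exact: cg].
have cK : compact (sum_map f g @` (C `*` U)).
  by apply: continuous_compact; [exact: continuous_subspaceT|exact: compact_setX].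
split => //; have t0 := transversality_gt0 wv.
apply: (expanding_image_pos t0) => // p p' [Cp Up] [Cp' Up'].
set a := p.1 - p'.1; set b := p.2 - p'.2.
have := transversal_expanding a b wv.
have := fC _ _ Cp Cp'; have := gU _ _ Up Up'; rewrite -/a -/b.
set x := f p.1 - f p'.1; set y := g p.2 - g p'.2.
have -> : sum_map f g p - sum_map f g p' = x + y by rewrite /sum_map opprD addrACA.
have decompose (z1 z2 z3 z4 : R * R) : z3 + z4 = z1 + z2 - (z1 - z3) - (z2 - z4).
  by apply: injective_projections => /=; ring.
rewrite (decompose x y (a *: w) (b *: v)).
have pab : `|p - p'| <= `|a| + `|b| by rewrite norm_pairE ge_max lerDl lerDr !normr_ge0.
have := ler_normB ((x + y) - (x - a *: w)) (y - b *: v).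
have := ler_normB (x + y) (x - a *: w).
have := normr_ge0 a; have := normr_ge0 b.
have := ler_wpM2l (ltW t0) pab.
have := ler_wpM2r (normr_ge0 a) ewv; have := ler_wpM2r (normr_ge0 b) ewv.
by move: (transversality w v) => T; lra.
Qed.

End AlmostAffine.

(** * Pieces of the rectifiable set and of the curve *)

Section Pieces.
Context {R : realType}.

Lemma elipschitz_norm (f : R -> R * R) : elipschitz f ->
  exists K, forall s t, `|f s - f t| <= K * `|s - t|.
Proof. by move=> [K fK]; exists K => s t; exact: le_trans (norm_le_enorm _) (fK s t). Qed.

Lemma rectifiable_pieces (A : set (R * R)) : hausdorff1.-caratheodory A ->
  countably_1_rectifiable A -> (0 < hausdorff1 A)%E ->
  exists f w, [/\ continuous f, w != 0 & forall e, 0 < e -> exists C : set R,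
    [/\ compact C, f @` C `<=` A, (0 < @lebesgue_measure R C)%E &
        almost_affine f C w e]].
Proof.
move=> cA [F [Flip F0]] A0.
have [i Ai] : exists i, hausdorff1 (A `&` range (F i)) <> 0%E.
  apply: contrapT => /forallNP Ai; move: A0; rewrite lt0e => /andP[/eqP + _]; apply.
  apply: (outer_measure_null_bigcup (mu := hausdorff1) (B := fun n =>
    if n is i.+1 then A `&` range (F i) else A `\` \bigcup_i range (F i))).
    move=> z Az; have [[i _ Fz]|nF] := pselect ((\bigcup_i range (F i)) z).
      by exists i.+1.
    by exists 0%N.
  by case=> [|i]; [exact: F0|exact: contrapT (Ai i)].
have [K fK] := elipschitz_norm (Flip i); set f := F i in Ai fK *.
have cf := lipschitz_continuous fK.
pose S := f @^-1` A.
have [|w /= w0 pieces] := @slope_pieces _ f S [set w | w != 0].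
  move=> S0; apply: Ai.
  apply: (outer_measure_null_bigcup (mu := hausdorff1) (B := fun n => match n with
    | 0%N => f @` [set t | ~ exists w, has_slope f t w]
    | 1%N => f @` [set t | has_slope f t 0]
    | 2%N => f @` [set t | S t /\ exists2 w, [set w | w != 0] w & has_slope f t w]
    | _ => set0 end)).
    move=> z [Az [t Tt tz]]; rewrite -tz; rewrite -tz in Az.
    have [[w fw]|nw] := pselect (exists w, has_slope f t w); last first.
      by exists 0%N => //; exists t.
    have [w0|w0] := eqVneq w 0; first by exists 1%N => //; exists t => //; rewrite -w0.
    by exists 2%N => //; exists t => //; split => //; exists w.
  case=> [|[|[|n]]]; [|exact: hausdorff1_image_slope0 fK|exact: S0|exact: hausdorff10].
  exact: hausdorff1_image_null fK (lipschitz_ae_has_slope fK).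
exists f, w; split => // e e0; have [P [PS Pb fP Paff]] := pieces e e0.
have fPA : f @` P `<=` A by move=> _ [t /PS St <-].
have [C [cC CP CA C0]] := caratheodory_preimage_compact fK cA Pb fPA fP.
exists C; split => //.
exact: almost_affine_sub CP (almost_affine_closure cf Paff).
Qed.

(** The projection of the curve along [w] is an interval with nonempty interior,
    because the curve is connected and not contained in a line parallel to [w].
    Sets of parameters without slope, and those where the slope is parallel to
    [w], have null projection. *)
Lemma curve_pieces (Gamma : set (R * R)) (w : R * R) :
  compact_rectifiable_curve Gamma -> ~ contained_in_line Gamma -> w != 0 ->
  exists g v, [/\ continuous g, det2 w v != 0 & forall e, 0 < e -> exists U : set R,
    [/\ compact U, g @` U `<=` Gamma, (0 < @lebesgue_measure R U)%E &
        almost_affine g U v e]].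
Proof.
move=> [a [b [gamma [ab cgamma rect ->]]]] noline w0.
have [g [glip [l gl]]] := rectifiable_path_lipschitz ab rect.
set G := gamma @` `[a, b] in noline *.
have glip1 s t : `|g s - g t| <= 1 * `|s - t| by rewrite mul1r.
have cg := lipschitz_continuous glip1.
have cG : compact G by apply: continuous_compact => //; exact: segment_compact.
have clG : closed G by apply: compact_closed cG; exact: norm_hausdorff.
pose q := det2 w.
have qlip x y : `|q x - q y| <= 2 * `|w| * `|x - y| by rewrite -det2B det2_le.
have [t1 t1ab qt1] : exists2 t1, a <= t1 <= b & q (gamma t1) != q (gamma a).
  apply: contrapT => noq; apply: noline; exists (gamma a), w; split => // _ [t tab <-].
  have qt : det2 w (gamma t - gamma a) = 0.
    rewrite det2B; apply/eqP; rewrite subr_eq0; apply/negPn/negP => qt; apply: noq.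
    by exists t => //; move: tab; rewrite /= in_itv.
  have [c tc] := det2_eq0 w0 qt; exists c => //.
  by rewrite -tc addrC subrK.
have qG : leb_outer (q @` G) <> 0%E.
  move=> qG0; have /andP[at1 t1b] := t1ab.
  have cqg : {within `[a, t1], continuous (q \o gamma)}.
    apply: (@continuous_subspaceW _ _ _ `[a, b]).
      by move=> t /=; rewrite !in_itv/= => /andP[-> /le_trans->].
    by apply: within_continuous_comp => // z _; exact: det2_continuous.
  have ivt (c d : R) : c < d -> `[c, d]%classic `<=` q @` G -> False.
    move=> cd cdG.
    have : lebesgue_measure (`[c, d]%classic : set R) = 0%E.
      exact: (outer_measure_null_sub (mu := leb_outer) cdG qG0).
    rewrite lebesgue_measure_itv /= lte_fin cd -EFinB => -[/eqP].
    by rewrite subr_eq0 gt_eqF.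
  apply: (ivt (Num.min (q (gamma a)) (q (gamma t1)))
              (Num.max (q (gamma a)) (q (gamma t1)))).
    by rewrite gt_min !lt_max !ltxx /= orbF -neq_lt eq_sym.
  move=> y; rewrite /= in_itv /= => yitv.
  have [t tat1 <-] := IVT at1 cqg yitv.
  exists (gamma t) => //; exists t => //.
  by move: tat1; rewrite /= !in_itv/= => /andP[-> /le_trans->].
pose S := g @^-1` G.
(* the projected curve, as a curve in the plane on which the Sard lemma applies *)
pose h t : R * R := (q (g t), 0).
have [|v /= wv pieces] := @slope_pieces _ g S [set v | det2 w v != 0].
  move=> S0; apply: qG.
  apply: (outer_measure_null_bigcup (mu := leb_outer) (B := fun n => match n with
    | 0%N => q @` (g @` [set t | ~ exists v, has_slope g t v])
    | 1%N => fst @` (h @` [set t | has_slope h t 0])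
    | 2%N => q @` (g @` [set t |
        S t /\ exists2 v, [set v | det2 w v != 0] v & has_slope g t v])
    | _ => set0 end)).
    move=> _ [_ [t tab <-] <-].
    have {}tab : a <= t <= b by move: tab; rewrite /= in_itv.
    have Sl : S (l t) by exists t => //; rewrite ?gl//= in_itv.
    rewrite -gl//.
    have [[v gv]|nv] := pselect (exists v, has_slope g (l t) v); last first.
      by exists 0%N => //; exists (g (l t)) => //; exists (l t).
    have [wv|wv] := eqVneq (det2 w v) 0; last first.
      exists 2%N => //; exists (g (l t)) => //; exists (l t) => //.
      by split => //; exists v.
    exists 1%N => //; exists (q (g (l t)), 0) => //; exists (l t) => //=.
    apply: (has_slope_pair (v := 0) (w := 0)).
      rewrite -wv; apply: (has_slope_comp_linear (c := 2 * `|w| + 1)) gv.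
      - exact: det2B.
      - exact: det2Z.
      - by rewrite ltr_wpDl// mulr_ge0.
      - by move=> x; rewrite (le_trans (det2_le _ _))// ler_wpM2r// lerDl.
    move=> e e0; exists 1 => // s _.
    by rewrite subrr scaler0 subr0 normr0 mulr_ge0// ltW.
  case=> [|[|[|n]]].
  - apply: lipschitz_functional_null qlip _.
    exact: hausdorff1_image_null glip1 (lipschitz_ae_has_slope glip1).
  - apply: (lipschitz_functional_null (c := 1)).
      by move=> x y; rewrite mul1r; exact: (norm_fst_le (x - y)).
    apply: (hausdorff1_image_slope0 (K := 2 * `|w|)) => s t.
    rewrite norm_pairE /= subr0 normr0 max_l//.
    by rewrite (le_trans (qlip _ _))// ler_wpM2l// mulr_ge0.
  - exact: lipschitz_functional_null qlip S0.
  - exact: (outer_measure0 leb_outer).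
exists g, v; split => // e e0; have [P [PS [M PM] gP Paff]] := pieces e e0.
have QM : closure P `<=` `[- M, M]%classic.
  have /closure_id -> : closed (`[- M, M]%classic : set R) by exact: itv_closed.
  by apply: closureS => t /PM; rewrite /= in_itv/= ler_norml.
exists (closure P); split => //.
- by apply: (subclosed_compact _ _ QM); [exact: closed_closure|exact: segment_compact].
- move=> _ [t Pt <-].
  have cS : closed S by exact: closed_preimage_continuous.
  by apply: cS; exact: closureS Pt.
- rewrite lt0e measure_ge0 andbT; apply/eqP => P0; apply: gP.
  apply: (outer_measure_null_sub (mu := hausdorff1) (B := g @` closure P)).
    by apply: image_subset; exact: subset_closure.
  exact: hausdorff1_image_null glip1 P0.
- exact: almost_affine_closure.
Qed.

End Pieces.

(** * Sum and difference sets *)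

Theorem theorem1p7 (R : realType) (Gamma E : set (R * R))
    (hGamma : compact_rectifiable_curve Gamma)
    (hline : ~ contained_in_line Gamma)
    (hE : exists A : set (R * R),
      [/\ A `<=` E, hausdorff1.-caratheodory A,
          countably_1_rectifiable A & (0 < hausdorff1 A)%E]) :
  exists Kplus Kminus : set (R * R),
    [/\ compact Kplus, Kplus `<=` [set x + y | x in E & y in Gamma] &
        (0 < planar_lebesgue Kplus)%E] /\
    [/\ compact Kminus, Kminus `<=` [set x - y | x in E & y in Gamma] &
        (0 < planar_lebesgue Kminus)%E].
Proof.
have [A [AE cA rA A0]] := hE.
have [f [w [cf w0 fpieces]]] := rectifiable_pieces cA rA A0.
have [g [v [cg wv gpieces]]] := curve_pieces hGamma hline w0.
have t0 := transversality_gt0 wv.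
have [C [cC CA C0 fC]] := fpieces _ t0.
have [U [cU UG U0 gU]] := gpieces _ t0.
(* the difference set is the sum set for [- g], whose slope is [- v] *)
have wNv : det2 w (- v) != 0.
  by rewrite -sub0r det2B subr_eq0 {1}/det2 /= !mulr0 subrr eq_sym.
have tN : transversality w v <= transversality w (- v) by rewrite transversalityN.
have cNg : continuous (\- g) by move=> t; apply: cvgN; exact: cg.
have [cKp Kp0] := sum_of_transversal_pieces cf cg cC cU C0 U0 wv (lexx _) fC gU.
have [cKm Km0] :=
  sum_of_transversal_pieces cf cNg cC cU C0 U0 wNv tN fC (almost_affineN gU).
exists (sum_map f g @` (C `*` U)), (sum_map f (\- g) @` (C `*` U)).
have EC p : C p.1 -> E (f p.1) by move=> Cp; apply: AE; apply: CA; exists p.1.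
have GU p : U p.2 -> Gamma (g p.2) by move=> Up; apply: UG; exists p.2.
split; split; [exact: cKp| |exact: Kp0|exact: cKm| |exact: Km0].
- move=> _ [p [Cp Up] <-]; exists (f p.1); first exact: EC.
  by exists (g p.2); first exact: GU.
- move=> _ [p [Cp Up] <-]; exists (f p.1); first exact: EC.
  by exists (g p.2); first exact: GU.
Qed.
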